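(* If $T$ is a tournament, then $\gamma_{\mathrm{cyc}}(T)=w(T)$.
   Context: A tournament is an orientation of a finite complete graph. A set $S$ of vertices of a digraph is dominating if every vertex is in $S$ or is an out-neighbour of a vertex in $S$. The cycle domination number $\gamma_{\mathrm{cyc}}(D)$ of a digraph $D$ is the length of the shortest directed cycle $C$ in $D$ such that the vertices in $C$ form a dominating set in $D$. A walk follows the direction of arcs and may repeat vertices and arcs; its length is the number of arcs traversed (counted with repetition); a single vertex is a closed walk of length $0$. A closed dominating walk is a closed walk whose vertex set is dominating. A watchman's walk is a closed dominating walk of minimum length, and $w(T)$ (the watchman number) is the length of a watchman's walk in $T$. Every tournament has a watchman's walk, so $w(T)$ is well defined.
   Formalization: A single vertex is counted as a directed cycle of length 0, since a tournament with a source (e.g. a transitive one) has no dominating directed cycle in the usual sense although w(T)=0; tournaments are taken to be nonempty. *)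

(* Defs.v *)
From mathcomp Require Import all_boot.
From mathcomp Require Import boolp.

Set Implicit Arguments.
Unset Strict Implicit.
Unset Printing Implicit Defensive.

(* A digraph is given by its arc relation on a finite vertex type. *)

Definition tournament (V : finType) (e : rel V) : bool :=
  [forall x, ~~ e x x] &&
  [forall x, forall y, (x != y) ==> (e x y (+) e y x)].

Definition dominating (V : finType) (e : rel V) (S : {set V}) : bool :=
  [forall v, (v \in S) || [exists u in S, e u v]].

(* The pair (x, p) stands for the walk visiting x :: p in this order; its
   length, the number of arcs, is size p. The case p = [::] is the walk of
   length 0 at x. *)
Definition closed_walk (V : finType) (e : rel V) (x : V) (p : seq V) : bool :=
  path e x p && (last x p == x).

(* Since last x p = x, the start x is itself listed in a nonempty p, so uniq p
   says that only the two ends of the closed walk coincide. As for walks, a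
   single vertex (p = [::]) counts as a cycle, of length 0: a vertex dominating
   the whole digraph without in-neighbours lies on no other cycle, and without
   this convention gamma_cyc would be undefined for, e.g., transitive
   tournaments. *)
Definition directed_cycle (V : finType) (e : rel V) (x : V) (p : seq V) : bool :=
  closed_walk e x p && uniq p.

Definition walk_vertices (V : finType) (x : V) (p : seq V) : {set V} :=
  [set v in x :: p].

Definition min_nat (P : pred nat) : option nat :=
  if pselect (exists n, P n) is left exP then Some (ex_minn exP) else None.

Definition gamma_cyc (V : finType) (e : rel V) : option nat :=
  min_nat (fun n => [exists x : V, exists p : n.-tuple V,
    directed_cycle e x p && dominating e (walk_vertices x p)]).

Definition watchman_number (V : finType) (e : rel V) : option nat :=
  min_nat (fun n => [exists x : V, exists p : n.-tuple V,
    closed_walk e x p && dominating e (walk_vertices x p)]).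

(* Main.v *)
Require Import Defs.
From mathcomp Require Import all_boot.
From mathcomp Require Import boolp.

(** Vertices of a closed walk induce a strong subtournament, and by Camion's
theorem a strong tournament has a Hamiltonian cycle, which is no longer than
the walk it comes from. Camion's theorem follows by enlarging a non-spanning
cycle C: an outside vertex that is both an out-neighbour and an in-neighbour
of C can be inserted in C; if no vertex can, strong connectivity provides an
arc b -> a where C dominates b and a dominates C, so that b, a can be inserted
between any two consecutive vertices of C. A dominating cycle exists since the
initial strong component of T is dominating. *)

Set Implicit Arguments.
Unset Strict Implicit.
Unset Printing Implicit Defensive.

(** Strength of the subdigraph induced by [S], in cut form: Camion's argument only ever asks for an
    arc leaving a given set. The points [a] and [b] make the cut nontrivial. *)
Definition strongly_connected (V : finType) (e : rel V) (S : {set V}) : Prop :=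
  forall A : {set V}, A \subset S -> forall a b, a \in A -> b \in S :\: A ->
  exists u w, [/\ u \in A, w \in S :\: A & e u w].

Lemma tournament_total (V : finType) (e : rel V) (x y : V) :
  tournament e -> x != y -> ~~ e x y -> e y x.
Proof.
by case/andP=> _ /forallP/(_ x)/forallP/(_ y)/implyP te /te; case: (e x y).
Qed.

Lemma tournament_irr (V : finType) (e : rel V) (x : V) :
  tournament e -> e x x = false.
Proof. by case/andP=> /forallP/(_ x)/negbTE. Qed.

Lemma tournament_asym (V : finType) (e : rel V) (x y : V) :
  tournament e -> e x y -> ~~ e y x.
Proof.
move=> te exy; have xy : x != y.
  by apply: contraTneq exy => ->; rewrite tournament_irr.
case/andP: te => _ /forallP/(_ x)/forallP/(_ y)/implyP/(_ xy).
by rewrite exy.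
Qed.

Lemma walk_vertices_nonempty (V : finType) (e : rel V) (x : V) (p : seq V) :
  closed_walk e x p -> p != [::] -> walk_vertices x p = [set v in p].
Proof.
case: p => // y p /andP[_ /eqP lx] _; apply/setP=> v; rewrite !inE.
by case: eqVneq => // ->; rewrite -[in RHS]lx /= -in_cons mem_last.
Qed.

(** Rotation lets a cycle be cut open at any of its vertices; [perm_eq] transports length, vertex
    set and absence of repetitions. *)
Lemma closed_walk_rot (V : finType) (e : rel V) (x y : V) (p : seq V) :
  closed_walk e x p -> y \in p -> exists2 q, closed_walk e y q & perm_eq q p.
Proof.
move=> /andP[+ /eqP +] yp; case/splitPr: yp => p1 p2.
rewrite cat_path last_cat /= => /and3P[xp1 ey yp2] lx.
exists (p2 ++ rcons p1 y); last by rewrite perm_catC cat_rcons.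
by rewrite /closed_walk cat_path rcons_path last_cat last_rcons lx yp2 xp1 ey /=.
Qed.

Lemma path_cut (V : finType) (e : rel V) (A : {set V}) (a b : V) (q : seq V) :
  path e a q -> a \in A -> b \in q -> b \notin A ->
  exists u w, [/\ u \in A, w \in q, w \notin A & e u w].
Proof.
elim: q a => // c q IH a /= /andP[eac cq] aA bcq bA.
have [cA|cA] := boolP (c \in A); last first.
  by exists a, c; rewrite aA cA eac mem_head.
move: bcq; rewrite inE => /orP[/eqP bc|bq]; first by rewrite bc cA in bA.
have [u [w [uA wq wA euw]]] := IH c cq cA bq bA.
by exists u, w; rewrite inE wq orbT.
Qed.

(** Once rotated to start at [a], the walk still meets [b], so one of its arcs leaves [A]. *)
Lemma closed_walk_strong (V : finType) (e : rel V) (x : V) (p : seq V) :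
  closed_walk e x p -> strongly_connected e (walk_vertices x p).
Proof.
move=> xp A sAp a b aA /setDP[bp bA].
have ap := subsetP sAp _ aA.
have p0 : p != [::].
  apply: contraNneq bA => p0; move: bp ap; rewrite p0 !inE.
  by move=> /eqP-> /eqP <-.
rewrite (walk_vertices_nonempty xp p0) in ap bp *; rewrite !inE in ap bp.
have [q /andP[aq _] qp] := closed_walk_rot xp ap.
rewrite -(perm_mem qp) in bp.
have [u [w [uA wq wA euw]]] := path_cut aq aA bp bA.
by exists u, w; rewrite !inE wA -(perm_mem qp) wq.
Qed.

(** Put [v] just before the first vertex of [p] that it beats: the preceding vertex beats [v], being
    either [x] or a vertex that [v] does not beat. *)
Lemma path_insert (V : finType) (e : rel V) (x v : V) (p : seq V) :
  tournament e -> path e x p -> v \notin p -> e x v -> has (e v) p ->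
  exists q, [/\ path e x q, last x q = last x p & perm_eq q (v :: p)].
Proof.
move=> te; elim: p x => // y p IH x /= /andP[exy yp].
rewrite inE negb_or => /andP[vy vp] exv hvp.
have [evy|evy] := boolP (e v y).
  by exists [:: v, y & p]; rewrite /= exv evy yp.
rewrite (negbTE evy) /= in hvp.
have [q [yq lq qp]] := IH y yp vp (tournament_total te vy evy) hvp.
exists (y :: q); rewrite /= exy yq; split=> //.
rewrite perm_sym -[_ :: _]/([:: v] ++ [:: y] ++ p) perm_catCA /= perm_cons.
by rewrite perm_sym.
Qed.

Lemma cycle_extend (V : finType) (e : rel V) (S : {set V}) (x : V) (p : seq V) :
  tournament e -> strongly_connected e S -> directed_cycle e x p ->
  walk_vertices x p \proper S ->
  exists y q, [/\ directed_cycle e y q, walk_vertices y q \subset S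
                & size p < size q].
Proof.
move=> te strS /andP[xp up] /properP[sCS [z zS zC]].
have insert v : v \in S -> v \notin walk_vertices x p ->
    (exists2 u, u \in walk_vertices x p & e u v) ->
    (exists2 w, w \in walk_vertices x p & e v w) ->
    exists y q, [/\ directed_cycle e y q, walk_vertices y q \subset S
                  & size p < size q].
  move=> vS vC [u uC euv] [w wC evw].
  (* On a one-vertex cycle [u] and [w] would coincide, giving arcs both ways between [u] and [v]. *)
  have p0 : p != [::].
    apply: contraTneq evw => p0; move: uC wC; rewrite p0 !inE.
    by move=> /eqP ux /eqP ->; rewrite -ux tournament_asym.
  move: uC wC vC sCS; rewrite (walk_vertices_nonempty xp p0) !inE => up' wp vp sp.
  have [q /andP[uq /eqP lq] qp] := closed_walk_rot xp up'.
  have vq : v \notin q by rewrite (perm_mem qp).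
  have hq : has (e v) q by apply/hasP; exists w; rewrite ?(perm_mem qp).
  have [r [ur lr rq]] := path_insert te uq vq euv hq.
  have cr : closed_walk e u r by rewrite /closed_walk ur lr lq /=.
  have rp : perm_eq r (v :: p) by rewrite (perm_trans rq) ?perm_cons.
  exists u, r; split; last by rewrite (perm_size rp).
    by rewrite /directed_cycle cr (perm_uniq rp) /= vp up.
  rewrite (walk_vertices_nonempty cr); last first.
    by rewrite -size_eq0 (perm_size rp).
  apply/subsetP=> t; rewrite inE (perm_mem rp) inE => /orP[/eqP-> //|tp].
  by apply: (subsetP sp); rewrite inE.
have xC : x \in walk_vertices x p by rewrite !inE eqxx.
have [|c0 [b0 [c0C b0C ecb]]] := strS _ sCS x z xC; first by rewrite inE zC.
(* The arc b -> a is found as an arc leaving [B], which contains [b0] and misses [x]. *)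
pose B := [set v in S :\: walk_vertices x p |
           [exists u in walk_vertices x p, e u v]].
have sBS : B \subset S by apply/subsetP=> t; rewrite !inE => /andP[/andP[]].
have b0B : b0 \in B by rewrite inE b0C; apply/existsP; exists c0; rewrite c0C.
have xSB : x \in S :\: B.
  by rewrite in_setD (subsetP sCS) // andbT inE in_setD xC.
have [b [a [bB /setDP[aS aB] eba]]] := strS _ sBS b0 x b0B xSB.
move: bB; rewrite inE => /andP[/setDP[bS bC'] /existsP[u /andP[uC eub]]].
have [/existsP[w /andP[wC ebw]]|nb] :=
    boolP [exists w in walk_vertices x p, e b w].
  by apply: (insert b) => //; [exists u | exists w].
have Cb w : w \in walk_vertices x p -> e w b.
  move=> wC; apply: (tournament_total te).
    by apply: contraNneq bC' => ->.
  by apply: contra nb => ebw; apply/existsP; exists w; rewrite wC.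
(* All of the cycle beats [b], whereas [b] beats [a]. Then [a], lying outside both the cycle and
   [B], is beaten by no vertex of the cycle. *)
have aC : a \notin walk_vertices x p.
  by apply: contraL eba => /Cb; apply: tournament_asym.
have aw w : w \in walk_vertices x p -> e a w.
  move=> wC; apply: (tournament_total te).
    by apply: contraNneq aC => <-.
  apply: contra aB => ewa; rewrite inE in_setD aC aS.
  by apply/existsP; exists w; rewrite wC.
have ab : a != b by apply: contraTneq eba => ->; rewrite tournament_irr.
(* The cycle of length 0 does not list [x] in [p], but the new cycle must return to [x]; there the
   length jumps from 0 to 3. *)
pose r := if p is [::] then [:: x] else p.
have [ar lr ur sr] : [/\ path e a r, last a r = x, uniq r & size p <= size r].
  have ax := aw x xC; move: xp up aw; rewrite /closed_walk {}/r; clear -ax.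
  case: p => [|y p] /=; first by rewrite ax.
  case/andP=> /andP[_ yp] /eqP lx up aw.
  by rewrite aw ?yp // !inE eqxx orbT.
have rC : [set v in r] = walk_vertices x p.
  rewrite /r; case: (p) xp => [|y p'] xp.
    by apply/setP=> t; rewrite !inE.
  by rewrite (walk_vertices_nonempty xp).
have mr t : (t \in r) = (t \in walk_vertices x p) by rewrite -rC inE.
exists x, [:: b, a & r]; split; last by rewrite /= ltnS (leq_trans sr).
  rewrite /directed_cycle /closed_walk /= (Cb x xC) eba ar lr eqxx ur.
  by rewrite inE negb_or eq_sym ab !mr bC' aC.
apply/subsetP=> t; rewrite inE 3!inE mr.
case/or4P=> [/eqP->|/eqP->|/eqP->|] //; exact: (subsetP sCS).
Qed.

Lemma strong_hamiltonian (V : finType) (e : rel V) (S : {set V}) (x : V) :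
  tournament e -> strongly_connected e S -> x \in S ->
  exists y q, directed_cycle e y q /\ walk_vertices y q = S.
Proof.
move=> te strS xS.
suff grow n y q : #|V| - size q <= n -> directed_cycle e y q ->
    walk_vertices y q \subset S ->
    exists y q, directed_cycle e y q /\ walk_vertices y q = S.
  apply: (grow #|V| x [::]); rewrite ?leq_subr //.
    by rewrite /directed_cycle /closed_walk /= eqxx.
  by apply/subsetP=> t; rewrite !inE => /eqP->.
elim: n y q => [|n IH] y q le_n cq sqS; case: (eqVproper sqS) => [<-|pqS];
    try (by exists y, q);
    have [z [r [cr srS ltqr]]] := cycle_extend te strS cq pqS;
    have le_r : size r <= #|V|
      by case/andP: cr => _ /card_uniqP<-; exact: max_card.
  (* For [n = 0] the cycle already has length at least [#|V|], so no longer one exists. *)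
  by move: (leq_trans ltqr le_r); rewrite -subn_gt0 ltnNge le_n.
apply: (IH z r) => //; rewrite -ltnS; apply: leq_trans le_n.
by rewrite ltn_sub2l // (leq_trans ltqr).
Qed.

(** Take [x] reaching the most vertices. If it missed [y], then y -> x, and [y] would reach
    everything [x] does and also itself. *)
Lemma tournament_source (V : finType) (e : rel V) :
  tournament e -> 0 < #|V| -> exists x, forall y, connect e x y.
Proof.
move=> te /card_gt0P[x0 _].
have [x _ xmax] := @arg_maxnP V x0 predT (fun x => #|connect e x|) isT.
exists x => y; apply/negPn/negP => nxy.
have eyx : e y x.
  apply: (tournament_total te); last by apply: contra nxy; apply: connect1.
  by apply: contraNneq nxy => ->.
have := xmax y isT; rewrite /= leqNgt => /negP; apply.
apply/proper_card/properP; split.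
  by apply/subsetP=> z; apply: connect_trans (connect1 eyx).
by exists y => //; exact: connect0.
Qed.

Lemma dominating_cycle (V : finType) (e : rel V) :
  tournament e -> 0 < #|V| ->
  exists x p, directed_cycle e x p /\ dominating e (walk_vertices x p).
Proof.
move=> te /(tournament_source te)[x xall].
(* Since [x] reaches every vertex, this is the initial strong component. *)
pose S := [set y | connect e y x].
have xS : x \in S by rewrite inE connect0.
have strS : strongly_connected e S.
  move=> A sAS a b aA /setDP[bS bA].
  have cax : connect e a x by move: (subsetP sAS a aA); rewrite inE.
  have /connectP[q aq lb] := connect_trans cax (xall b).
  have bq : b \in q.
    by move: (mem_last a q); rewrite -lb inE => /predU1P[ba|//]; rewrite ba aA in bA.
  have [u [w [uA wq wA euw]]] := path_cut aq aA bq bA.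
  (* The rest of the path leads from [w] to [b], and [b] reaches [x]; hence [w] is in [S]. *)
  exists u, w; split=> //; rewrite inE wA inE.
  apply: (@connect_trans _ _ b); last by rewrite inE in bS.
  case/splitPr: wq aq lb {bq} => q1 q2; rewrite cat_path last_cat /=.
  by case/and3P=> _ _ wq2 lb; apply/connectP; exists q2.
have [y [q [cq qS]]] := strong_hamiltonian te strS xS.
exists y, q; split=> //; rewrite qS; apply/forallP=> v.
(* A vertex outside [S] has no arc to [x], so [x] itself dominates it. *)
have [//|vS] := boolP (v \in S); apply/existsP; exists x; rewrite xS /=.
apply: (tournament_total te); first by apply: contraNneq vS => ->.
by apply: contra vS => evx; rewrite inE connect1.
Qed.

Lemma closed_walk_cycle (V : finType) (e : rel V) (x : V) (p : seq V) :
  tournament e -> closed_walk e x p ->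
  exists y q, [/\ directed_cycle e y q, walk_vertices y q = walk_vertices x p
                & size q <= size p].
Proof.
move=> te xp; have [p0|p0] := eqVneq p [::].
  by exists x, p; split=> //; rewrite /directed_cycle xp p0.
have [|y [q [cq qp]]] := strong_hamiltonian te (closed_walk_strong xp) (x := x).
  by rewrite !inE eqxx.
(* The entries of [q] are distinct and all occur in [p]. This needs [x] to be listed in [p], hence
   the separate case of length 0. *)
exists y, q; split=> //; case/andP: cq => _ uq; apply: uniq_leq_size => // t tq.
have : t \in walk_vertices y q by rewrite !inE tq orbT.
by rewrite qp (walk_vertices_nonempty xp p0) inE.
Qed.

(** Meant for [P] the lengths of dominating cycles and [Q] those of closed dominating walks:
    shrinking a shortest walk to a cycle bounds the first minimum by the second. *)
Lemma min_nat_eq (P Q : pred nat) :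
  (exists n, P n) -> subpred P Q -> (forall n, Q n -> exists2 m, m <= n & P m) ->
  exists k, min_nat P = Some k /\ min_nat Q = Some k.
Proof.
move=> exP PQ QP; rewrite /min_nat; case: pselect => // exP'.
case: pselect => [exQ'|[]]; last by case: exP => n /PQ; exists n.
case: ex_minnP => m Pm minm; case: ex_minnP => n Qn minn.
exists m; split=> //; congr Some; apply/eqP; rewrite eqn_leq minn ?PQ //=.
by have [k kn /minm mk] := QP n Qn; apply: leq_trans kn.
Qed.

Theorem theorem4p8 (V : finType) (e : rel V) (V_gt0 : 0 < #|V|)
    (tourn_e : tournament e) :
  exists k : nat, gamma_cyc e = Some k /\ watchman_number e = Some k.
Proof.
apply: min_nat_eq.
- have [x [p [cp dp]]] := dominating_cycle tourn_e V_gt0.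
  exists (size p); apply/existsP; exists x; apply/existsP; exists (in_tuple p).
  by rewrite cp dp.
- move=> n /existsP[x /existsP[p /andP[/andP[xp _] dp]]].
  by apply/existsP; exists x; apply/existsP; exists p; rewrite xp dp.
- move=> n /existsP[x /existsP[p /andP[xp dp]]].
  have [y [q [cq qp le_qp]]] := closed_walk_cycle tourn_e xp.
  exists (size q); first by rewrite size_tuple in le_qp.
  apply/existsP; exists y; apply/existsP; exists (in_tuple q).
  by rewrite cq qp dp.
Qed.
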